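(* Let $K$ be a quartic number field whose normal closure (over $\mathbb{Q}$) has Galois group $V_4$ (the Klein four-group). Then every two-times monogenic order in $K$ is of type I.
   Context: Let $K$ be a number field with ring of integers $O_K$. An order $O$ in $K$ is a subring of $O_K$ with quotient field $K$. It is monogenic if $O=\mathbb{Z}[\alpha]$ for some $\alpha\in O$; such an $\alpha$ is called a monogenizer of $O$. Two monogenizers $\alpha,\alpha'$ of $O$ are $\mathbb{Z}$-equivalent if $\alpha'=\pm\alpha+c$ for some $c\in\mathbb{Z}$. The order $O$ is two-times monogenic if there exist $\alpha,\beta\in O$, not $\mathbb{Z}$-equivalent, with $O=\mathbb{Z}[\alpha]=\mathbb{Z}[\beta]$. A monogenic order $O$ in $K$ is of type I if there exist $\alpha,\beta\in O$ and $\begin{pmatrix} m_1 & m_2\\ m_3 & m_4\end{pmatrix}\in \mathrm{GL}_2(\mathbb{Z})$ such that $K=\mathbb{Q}(\alpha)$, $O=\mathbb{Z}[\alpha]=\mathbb{Z}[\beta]$, $\beta=\frac{m_1\alpha+m_2}{m_3\alpha+m_4}$ and $m_3\neq 0$. *)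

(* Defs.v *)
From HB Require Import structures.
From mathcomp Require Import all_boot all_order all_algebra all_fingroup.
From mathcomp Require Import all_solvable all_field.
Set Implicit Arguments. Unset Strict Implicit. Unset Printing Implicit Defensive.
Import GRing.Theory.
Local Open Scope ring_scope.

Definition is_order (K : fieldExtType rat) (O : {pred K}) : Prop :=
  [/\ subring_closed O,
      forall x, x \in O -> integralOver (intr : int -> K) x
    & forall x, exists a b, [/\ a \in O, b \in O, b != 0 & x = a / b]].

(* [a] lies in [O] and [O = Z[a]]. *)
Definition monogenizer (K : fieldExtType rat) (O : {pred K}) (a : K) : Prop :=
  a \in O /\
  forall x, x \in O <-> exists p : {poly int}, x = (map_poly intr p).[a].

Definition Z_equivalent (K : fieldExtType rat) (a a' : K) : Prop :=
  exists c : int, a' = a + c%:~R \/ a' = - a + c%:~R.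

Definition two_times_monogenic (K : fieldExtType rat) (O : {pred K}) : Prop :=
  exists a b, [/\ monogenizer O a, monogenizer O b & ~ Z_equivalent a b].

(* The entries [m1 m2 / m3 m4] are [M 0 0, M 0 1, M 1 0, M 1 1], and GL_2(Z) is
   the set of [M : 'M[int]_2] in [unitmx].  As division by 0 is total here, a
   meaningful fraction requires the explicit nonvanishing of its denominator. *)
Definition type_I (K : fieldExtType rat) (O : {pred K}) : Prop :=
  exists a b, exists M : 'M[int]_2,
    [/\ <<1; a>>%VS = fullv, monogenizer O a, monogenizer O b & M \in unitmx]
    /\ [/\ M 1 0 != 0, (M 1 0)%:~R * a + (M 1 1)%:~R != 0 &
           b = ((M 0 0)%:~R * a + (M 0 1)%:~R) /
               ((M 1 0)%:~R * a + (M 1 1)%:~R)].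

(* The splitting fields over [rat] are the finite normal extensions of Q, so
   this says that [L], with the embedding [iota], is a normal extension of Q
   containing [K], and that no proper subfield of [L] is. *)
Definition is_normal_closure (K : fieldExtType rat) (L : splittingFieldType rat)
    (iota : 'AHom(K, L)) : Prop :=
  forall E : {subfield L},
    (limg iota <= E)%VS -> normalField 1 E -> E = {:L}%AS.

Definition klein_four : {group 'Z_2 * 'Z_2} := [set: 'Z_2 * 'Z_2]%G.

(* Main.v *)
Require Import Defs.
From HB Require Import structures.
From mathcomp Require Import all_boot all_order all_algebra all_fingroup.
From mathcomp Require Import all_solvable all_field.
From mathcomp Require Import ring zify.
Import GRing.Theory Num.Theory.
Local Open Scope ring_scope.
Set Implicit Arguments.
Unset Strict Implicit.
Unset Printing Implicit Defensive.

(** The order [O = Z[a] = Z[b]] lives in a biquadratic field [K]; write [1, s, t, s t]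
    for its Galois group and [x0, x1, x2, x3] for the corresponding conjugates
    of an element [x].

    Step 1: a rational Moebius relation.  The three products of differences

      [D1 x = (x0 - x1)(x2 - x3)], [D2 x = (x0 - x2)(x1 - x3)],
      [D3 x = (x0 - x3)(x1 - x2)]

    are invariant under the whole Klein four-group, hence rational.  As [a] and
    [b] are integral polynomials in each other, each quotient [Di b / Di a] is
    an algebraic integer with integral inverse; being rational, it is [1] or
    [-1] ([sign_of_fixed_product]).  The Pluecker relation [D1 - D2 + D3 = 0]
    holds for [a] and for [b], which forces the signs for [D1] and [D2] to
    agree ([pluecker_signs]).  So [a] and [b] have the same cross-ratio of
    conjugates, that is, the matrix of the conjugates of [1, a, b, a b] is
    singular ([det_bilinear_rows]).  By Dedekind's independence of
    automorphisms, [1, a, b, a b] cannot span [K] ([klein_four_dependent]), so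
    there is a primitive integral relation [m3 a b + m4 b = m1 a + m2]
    ([primitive_relation]).

    Step 2: the relation is unimodular.  If a prime [p] divides the determinant
    [m1 m4 - m2 m3], then modulo [p] the relation factors as [y z = 0] with
    [y], [z] translates of [a], [b] by integers.  Writing [z = z(0) + y k(y)] as
    a polynomial in [y] gives [z z = z(0) z], so the ring [O / p O], generated
    by [z], has dimension at most [2] over [Z / p Z], whereas its dimension is [4]
    ([shifted_product_dvd1], [mobius_unimodular]).

    Finally, [m3 = 0] would make [m4] and [m1] equal to [1] or [-1], and [b]
    equivalent to [a]; so [m3 <> 0] and [b = (m1 a + m2) / (m3 a + m4)]. *)

(** * Integral minimal polynomials *)

Section MinimalPolynomial.
Variable K : fieldExtType rat.
Implicit Types (a b x : K) (p q : {poly int}) (d : int).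

Local Notation eval q x := (map_poly (intr : int -> K) q).[x].

(** By Gauss's lemma [f] is a rational multiple of an integer polynomial dividing
    [q], and the leading coefficient of the latter divides [1]. *)
Lemma monic_int_factor (f : {poly rat}) q :
    f \is monic -> q \is monic -> f %| map_poly intr q ->
  exists2 p, p \is monic & f = map_poly intr p.
Proof.
move=> f_monic q_monic /dvdpP_rat_int[p [c c_neq0 fE] [r qE]].
have lead_unit : lead_coef p * lead_coef r = 1.
  by rewrite -lead_coefM -qE (eqP q_monic).
have lead_pE : (lead_coef p == 1) || (lead_coef p == -1).
  have : (lead_coef p) \is a GRing.unit.
    by apply/unitrPr; exists (lead_coef r).
  by [].
have injZQ : injective (intr : int -> rat) by apply: intr_inj.
have := monicP f_monic; rewrite fE lead_coefZ lead_coef_map_inj //.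
case/orP: lead_pE => /eqP lead_pE; rewrite lead_pE.
  rewrite mulr1 => ->; exists p; first by apply/monicP.
  by rewrite scale1r.
move=> cE; have -> : c = -1 by rewrite -[c]opprK -[- c]mulrN1 cE.
exists (- p); first by apply/monicP; rewrite lead_coefN lead_pE opprK.
by rewrite scaleN1r rmorphN.
Qed.

Lemma map_poly_alg_intr q :
  map_poly (in_alg K) (map_poly intr q) = map_poly intr q.
Proof.
by rewrite -map_poly_comp; apply: eq_map_poly => z; rewrite /= scaler_int.
Qed.

Lemma integral_minPoly a : integralOver (intr : int -> K) a ->
  exists p, [/\ p \is monic, size p = (adjoin_degree 1 a).+1 & eval p a = 0].
Proof.
case=> q q_monic q_root.
have /polyOver1P[f fE] := minPolyOver 1 a.
have f_monic : f \is monic.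
  by have := monic_minPoly 1 a; rewrite fE map_monic.
have dvd_f : f %| map_poly intr q.
  rewrite -(dvdp_map (in_alg K)) -fE map_poly_alg_intr.
  apply: minPoly_dvdp q_root; rewrite -map_poly_alg_intr.
  by apply/polyOver1P; eexists.
have [p p_monic fpE] := monic_int_factor f_monic q_monic dvd_f.
exists p; split=> //.
  rewrite -(size_minPoly 1%VS) fE size_map_poly fpE size_map_inj_poly //.
  exact: intr_inj.
apply/eqP; have := root_minPoly 1 a.
by rewrite fE fpE map_poly_alg_intr.
Qed.

Lemma rational_integral_int (c : rat) :
  integralOver (intr : int -> K) c%:A -> exists d, c = d%:~R.
Proof.
case/integral_minPoly=> p [p_monic + p_root].
have /eqP-> : adjoin_degree 1 (c%:A : K) == 1%N.
  by rewrite (adjoin_deg_eq1 1%AS) rpredZ ?mem1v.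
move=> size_p; exists (- p`_0).
have p1 : p`_1 = 1 by have := monicP p_monic; rewrite lead_coefE size_p.
have := p_root; rewrite (@horner_coef_wide _ 2); last first.
  by rewrite (leq_trans (size_poly _ _)) ?size_p.
rewrite !big_ord_recl big_ord0 !coef_map /= p1 expr0 expr1 !mulr1 addr0 mul1r.
move/eqP; rewrite addrC addr_eq0 => /eqP cE.
by apply: (fmorph_inj (in_alg K)); rewrite /= cE scaler_int rmorphN.
Qed.

(** The powers of [a] below its degree remain independent modulo [d] in [Z[a]]:
    the minimal polynomial of [a] is monic with integer coefficients, so [q] can
    be replaced by its remainder, and then coefficients can be compared. *)
Lemma small_eval_dvd a p q d :
    integralOver (intr : int -> K) a -> (size p <= adjoin_degree 1 a)%N ->
    eval p a = d%:~R * eval q a ->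
  forall i, (d %| p`_i)%Z.
Proof.
case/integral_minPoly=> m [m_monic size_m m_root] size_p pE i.
set t := Pdiv.Ring.rmodp q m.
have size_t : (size t <= adjoin_degree 1 a)%N.
  by rewrite -ltnS -size_m Pdiv.Ring.ltn_rmodpN0 ?monic_neq0.
have tE : eval q a = eval t a.
  rewrite {1}(Pdiv.RingMonic.rdivp_eq m_monic q).
  by rewrite rmorphD rmorphM /= hornerD hornerM m_root mulr0 add0r.
suff -> : p = d *: t by rewrite coefZ dvdz_mulr.
have injZK : injective (intr : int -> K).
  move=> u v /eqP; rewrite -subr_eq0 -rmorphB /= -scaler_int scaler_eq0.
  by rewrite oner_eq0 orbF intr_eq0 subr_eq0 => /eqP.
apply: (map_inj_poly injZK (rmorph0 _)).
apply/eqP; rewrite -subr_eq0 -rmorphB -(@root_small_adjoin_poly _ _ 1%AS a).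
- rewrite rootE rmorphB /= map_polyZ hornerD hornerN hornerZ pE tE.
  by rewrite subrr.
- apply/polyOver1P; exists (map_poly intr (p - d *: t)).
  by rewrite map_poly_alg_intr.
rewrite (leq_trans (size_poly _ _)) //.
rewrite (leq_trans (size_polyD _ _)) // geq_max size_p size_polyN.
by rewrite (leq_trans (size_scale_leq _ _)).
Qed.

End MinimalPolynomial.

(** * Moebius relations between two generators of the same order *)

Lemma eval_rmorph (K1 K2 : fieldExtType rat) (f : {rmorphism K1 -> K2})
    (q : {poly int}) (x : K1) :
  f (map_poly intr q).[x] = (map_poly intr q).[f x].
Proof.
rewrite -horner_map -map_poly_comp /=; congr (_.[_]).
by apply: eq_map_poly => z /=; rewrite rmorph_int.
Qed.

Lemma integral_image (K1 K2 : fieldExtType rat) (f : {rmorphism K1 -> K2}) x :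
  integralOver (intr : int -> K1) x -> integralOver (intr : int -> K2) (f x).
Proof.
case=> p p_monic /eqP p_root; exists p => //.
by apply/eqP; rewrite -eval_rmorph p_root rmorph0.
Qed.

Section Unimodular.
Variable K : fieldExtType rat.
Implicit Types (a b x y z : K) (p q r g h w : {poly int}) (c d e m : int).

Local Notation eval q x := (map_poly (intr : int -> K) q).[x].

Lemma evalC c x : eval c%:P x = c%:~R.
Proof. by rewrite map_polyC hornerC. Qed.

Lemma evalX x : eval 'X x = x.
Proof. by rewrite map_polyX hornerX. Qed.

Lemma evalD p q x : eval (p + q) x = eval p x + eval q x.
Proof. by rewrite rmorphD hornerD. Qed.

Lemma evalN p x : eval (- p) x = - eval p x.
Proof. by rewrite rmorphN hornerN. Qed.

Lemma evalM p q x : eval (p * q) x = eval p x * eval q x.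
Proof. by rewrite rmorphM hornerM. Qed.

Definition evalE := (evalC, evalX, evalD, evalN, evalM).

Lemma eval_factor q c x :
  exists r, eval q x = (q.[c])%:~R + (x - c%:~R) * eval r x.
Proof.
have [|r rE] := factor_theorem (q - q.[c]%:P) c _.
  by rewrite rootE !hornerE subrr.
exists r; have {1}-> : q = r * ('X - c%:P) + q.[c]%:P by rewrite -rE subrK.
by rewrite !evalE; ring.
Qed.

(** Put [y = a - c] and [z = b - e].  As a polynomial in [a], [z] is an integer plus
    a multiple of [y], so [y * z = 0] modulo [d] makes [z * z] an integer multiple
    of [z] modulo [d].  Then [1] and [z] span [Z[b] = Z[a]] modulo [d], which is
    incompatible with the independence of [1], [a], [a * a] unless the quotient
    ring is zero. *)
Lemma shifted_product_dvd1 a b c e d g h w :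
    integralOver (intr : int -> K) a -> (2 < adjoin_degree 1 a)%N ->
    b = eval g a -> a = eval h b ->
    (a - c%:~R) * (b - e%:~R) = d%:~R * eval w a ->
  (d %| 1)%Z.
Proof.
move=> a_int deg_a bE aE prodE; set z := b - e%:~R in prodE.
have [k zE] : exists k, z = (g.[c] - e)%:~R + (a - c%:~R) * eval k a.
  have [k kE] := eval_factor g c a.
  by exists k; rewrite /z {1}bE kE; ring.
have bz : b = z + e%:~R by rewrite subrK.
have z2E : z * z - ((g.[c] - e)%:~R * z + d%:~R * (eval k a * eval w a)) = 0.
  by rewrite mulrCA -prodE {1}zE; ring.
clearbody z.
have span q : exists u v r, eval q b = u%:~R + v%:~R * z + d%:~R * eval r a.
  elim/poly_ind: q => [|q s [u [v [r qE]]]].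
    by exists 0, 0, 0; rewrite !rmorph0 !horner0; ring.
  exists (u * e + s), (u + v * (g.[c] - e) + v * e).
  exists (v%:P * k * w + r * g); rewrite !evalE qE -bE bz.
  apply/eqP; rewrite -subr_eq0 -[X in _ == X](mulr0 v%:~R) -[in X in _ == X]z2E.
  by apply/eqP; ring.
have [u [v [r]]] := span h; rewrite -aE => /eqP; rewrite -subr_eq0 => /eqP a1E.
have [u' [v' [r']]] := span (h * h); rewrite evalM -aE => /eqP.
rewrite -subr_eq0 => /eqP a2E.
(* Eliminating [z] between the expressions of [a] and [a * a] shows [d %| v]. *)
have /dvdzP[t vE] : (d %| v)%Z.
  pose f := Poly [:: v' * u - v * u'; - v'; v].
  have size_f : (size f <= adjoin_degree 1 a)%N.
    by apply: leq_trans deg_a; rewrite (leq_trans (size_Poly _)).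
  have := small_eval_dvd (q := v%:P * r' - v'%:P * r) (d := d) a_int size_f _ 2.
  rewrite /f coef_Poly /=; apply; rewrite /= !cons_poly_def !evalE.
  apply/eqP; rewrite -subr_eq0; apply/eqP.
  transitivity (v%:~R * (a * a - (u'%:~R + v'%:~R * z + d%:~R * eval r' a))
               - v'%:~R * (a - (u%:~R + v%:~R * z + d%:~R * eval r a))).
    by ring.
  by rewrite a1E a2E !mulr0 subr0.
(* Hence [a] is congruent to the integer [u] modulo [d], so [d] divides the leading
   coefficient of ['X - u]. *)
pose f := Poly [:: - u; 1].
have size_f : (size f <= adjoin_degree 1 a)%N.
  by apply: leq_trans (ltnW deg_a); rewrite (leq_trans (size_Poly _)).
have := small_eval_dvd (q := t%:P * (g - e%:P) + r) (d := d) a_int size_f _ 1.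
rewrite /f coef_Poly /=; apply; rewrite /= !cons_poly_def !evalE -bE bz.
by apply/eqP; rewrite -subr_eq0 -a1E vE; apply/eqP; ring.
Qed.

Lemma linear_eval_dvd a u v d w :
    integralOver (intr : int -> K) a -> (1 < adjoin_degree 1 a)%N ->
    u%:~R * a + v%:~R = d%:~R * eval w a ->
  (d %| u)%Z && (d %| v)%Z.
Proof.
move=> a_int deg_a uvE; pose f := Poly [:: v; u].
have size_f : (size f <= adjoin_degree 1 a)%N.
  by apply: leq_trans deg_a; rewrite (leq_trans (size_Poly _)).
have dvd_f : forall i, (d %| f`_i)%Z.
  apply: (small_eval_dvd (q := w) a_int) => //; rewrite -uvE /f.
  by rewrite /= !cons_poly_def !evalE; ring.
by have := (dvd_f 0, dvd_f 1); rewrite !coef_Poly /= => -[-> ->].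
Qed.

(** Modulo a prime [p] dividing the determinant, the bilinear relation has rank
    one.  If [p] does not divide [m3], dividing by [m3] makes it a product of a
    translate of [a] and a translate of [b], which [shifted_product_dvd1]
    excludes.  If [p] divides [m3], it becomes a congruence in [a] alone or in
    [b] alone, so [p] divides all the coefficients. *)
Lemma mobius_unimodular a b g h m1 m2 m3 m4 :
    integralOver (intr : int -> K) a -> (2 < adjoin_degree 1 a)%N ->
    integralOver (intr : int -> K) b -> (1 < adjoin_degree 1 b)%N ->
    b = eval g a -> a = eval h b ->
    m3%:~R * (a * b) + m4%:~R * b = m1%:~R * a + m2%:~R ->
    (forall p : nat, prime p ->
       ~~ [&& (p %| m1)%Z, (p %| m2)%Z, (p %| m3)%Z & (p %| m4)%Z]) ->
  m1 * m4 - m2 * m3 \is a GRing.unit.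
Proof.
move=> a_int deg_a b_int deg_b bE aE relE primitive; set det := m1 * m4 - m2 * m3.
have [det_1|det_n1] := eqVneq `|det|%N 1%N.
  by rewrite -[_ \is a _]/((det == 1) || (det == -1)); lia.
have [p p_prime p_dvd] : exists2 p, prime p & (p %| `|det|)%N.
  case: (posnP `|det|%N) => [->|det_gt0]; first by exists 2.
  exists (pdiv `|det|); last exact: pdiv_dvd.
  by rewrite pdiv_prime // ltn_neqAle eq_sym det_n1.
have p_ndvd1 : ~~ (p %| 1)%Z by rewrite dvdzE /= dvdn1; case: p p_prime {p_dvd} => [|[]].
have /dvdzP[t detE] : (p %| det)%Z by rewrite dvdzE.
have [p_dvd_m3|p_ndvd_m3] := boolP (p %| m3)%Z.
  have /dvdzP[k m3E] := p_dvd_m3.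
  have : (p %| m1 * m4)%Z.
    apply/dvdzP; exists (t + m2 * k).
    by rewrite mulrDl -detE -mulrA -m3E subrK.
  rewrite dvdzE abszM Euclid_dvdM // => /orP[] p_dvd'.
    have /dvdzP[l m1E] : (p %| m1)%Z by rewrite dvdzE.
    have /andP[p_m4] : (p %| m4)%Z && (p %| - m2)%Z.
      apply: (@linear_eval_dvd b m4 (- m2) p (l%:P * h - k%:P * h * 'X)) => //.
      rewrite !evalE -aE.
      transitivity (m4%:~R * b - (m1%:~R * a + m2%:~R) + m1%:~R * a); first by ring.
      by rewrite -relE m1E m3E; ring.
    rewrite rpredN => p_m2; have := primitive p p_prime.
    by rewrite p_m2 p_m4 p_dvd_m3 dvdzE p_dvd'.
  have /dvdzP[l m4E] : (p %| m4)%Z by rewrite dvdzE.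
  have /andP[p_m1 p_m2] : (p %| m1)%Z && (p %| m2)%Z.
    apply: (@linear_eval_dvd a m1 m2 p ((k%:P * 'X + l%:P) * g)) => //.
      exact: ltnW.
    by rewrite !evalE -bE -relE m3E m4E; ring.
  by have := primitive p p_prime; rewrite p_m1 p_m2 p_dvd_m3 dvdzE p_dvd'.
(* [s] is an inverse of [m3] modulo [p]. *)
have [s [k bezout]] := Bezoutz m3 p.
have {bezout} sE : s * m3 = 1 - k * p.
  have /eqP m3_p : coprimez m3 p.
    by rewrite coprimez_sym coprimezE prime_coprime.
  by rewrite -m3_p -bezout addrK.
case/negP: p_ndvd1.
apply: (@shifted_product_dvd1 a b (- (s * m4)) (s * m1) p g h
          (k%:P * 'X * g + (s * k * m2 - s * s * t)%:P)) => //.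
rewrite !evalE -bE.
have sE' : s%:~R * m3%:~R = 1 - k%:~R * p%:~R :> K.
  by rewrite -!intrM sE rmorphB.
have detE' : m1%:~R * m4%:~R - m2%:~R * m3%:~R = t%:~R * p%:~R :> K.
  by rewrite -!intrM -rmorphB -detE.
(* The difference of the two sides is a combination of the three relations. *)
apply/eqP; rewrite -subr_eq0; apply/eqP.
transitivity (s%:~R * (m3%:~R * (a * b) + m4%:~R * b - (m1%:~R * a + m2%:~R))
  - (a * b + s%:~R * m2%:~R) * (s%:~R * m3%:~R - (1 - k%:~R * p%:~R))
  - s%:~R ^+ 2 * (m1%:~R * m4%:~R - m2%:~R * m3%:~R - t%:~R * p%:~R)).
  by ring.
by rewrite relE sE' detE' !subrr !mulr0 !subr0.
Qed.

End Unimodular.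

(** * The Klein four-group *)

Lemma isog_klein_four (gT : finGroupType) (G : {group gT}) :
    (G \isog klein_four)%g ->
  exists s t : gT, [/\ uniq [:: 1; s; t; s * t]%g,
    (s * s = 1)%g, (t * t = 1)%g, (s * t = t * s)%g & G :=: [set 1; s; t; s * t]%g].
Proof.
rewrite isog_sym => /isogP[f f_inj fG].
pose u : 'Z_2 * 'Z_2 := (1, 0)%R; pose v : 'Z_2 * 'Z_2 := (0, 1)%R.
have inT z : z \in klein_four by rewrite inE.
have f1 : f 1%g = 1%g by apply: morph1.
have fM x y : f (x * y)%g = (f x * f y)%g by rewrite morphM.
have all4 (z : 'Z_2 * 'Z_2) : z \in [:: 1; u; v; u * v]%g.
  by case: z => [[[|[|//]] ?] [[|[|//]] ?]].
exists (f u), (f v); split; rewrite -?fM -?f1.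
- rewrite -[[:: _; _; _; _]]/(map f [:: 1; u; v; u * v]%g) map_inj_uniq //.
  by move=> x y; apply: (injmP f_inj).
- by congr (f _); apply/eqP.
- by congr (f _); apply/eqP.
- by congr (f _); apply/eqP.
apply/setP=> y; rewrite -fG; apply/morphimP/idP => [[z _ _ ->]|].
  by have := all4 z; rewrite !inE => /or4P[]/eqP->; rewrite eqxx ?orbT.
by rewrite !inE => /orP[/orP[/orP[]|]|]/eqP->; eexists.
Qed.

(** * A determinant detecting equal cross-ratios *)

Lemma det_mx22 (R : comNzRingType) (M : 'M[R]_2) :
  \det M = M 0 0 * M (lift 0 0) (lift 0 0) - M 0 (lift 0 0) * M (lift 0 0) 0.
Proof.
rewrite (expand_det_row _ 0) !big_ord_recl big_ord0 /cofactor !det_mx11 !mxE.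
rewrite /= !(ord1, lift0) /bump /=.
have -> : lift (lift 0 0) 0 = 0 :> 'I_2 by apply/val_inj.
ring.
Qed.

Lemma det_mx33 (R : comNzRingType) (M : 'M[R]_3) :
  let o1 := lift 0 0 in let o2 := lift 0 (lift 0 0) in
  \det M = M 0 0 * (M o1 o1 * M o2 o2 - M o1 o2 * M o2 o1)
         - M 0 o1 * (M o1 0 * M o2 o2 - M o1 o2 * M o2 0)
         + M 0 o2 * (M o1 0 * M o2 o1 - M o1 o1 * M o2 0).
Proof.
move=> o1 o2.
rewrite (expand_det_row _ 0) !big_ord_recl big_ord0 /cofactor !det_mx22 !mxE.
rewrite /= -/o1 -/o2 /bump /=.
have -> : lift o1 0 = 0 by apply/val_inj.
have -> : lift o2 0 = 0 by apply/val_inj.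
have -> : lift o1 (lift 0 0) = o2 by apply/val_inj.
have -> : lift o2 (lift 0 0) = o1 by apply/val_inj.
ring.
Qed.

(** For four distinct [x i] and four distinct [y i], equality of the two
    cross-ratios is thus the same as a nonzero bilinear relation
    [m3 x y + m4 y = m1 x + m2] holding at the four points. *)
Lemma det_bilinear_rows (F : fieldType) (x y : nat -> F) :
  \det (\matrix_(i < 4, j < 4) nth 0 [:: 1; x i; y i; x i * y i] j)
  = (x 0%N - x 1%N) * (x 2%N - x 3%N) * ((y 0%N - y 2%N) * (y 1%N - y 3%N))
    - (x 0%N - x 2%N) * (x 1%N - x 3%N) * ((y 0%N - y 1%N) * (y 2%N - y 3%N)).
Proof.
rewrite (expand_det_row _ 0) !big_ord_recl big_ord0 /cofactor.
rewrite !det_mx33.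
rewrite !mxE /bump /=.
ring.
Qed.

(** * Conjugates in a Klein four-extension *)

Section Galois.
Variable L : splittingFieldType rat.
Implicit Types (x y z : L) (g h : {poly int}).

Local Notation eval q x := (map_poly (intr : int -> L) q).[x].
Local Notation integral := (integralOver (intr : int -> L)).

Lemma integral_eval g x : integral x -> integral (eval g x).
Proof.
move=> x_int; apply: integral_horner x_int => _ /(nthP 0)[i _ <-].
by rewrite coef_map; apply: integral_id.
Qed.

Lemma eval_difference g x y : integral x -> integral y ->
  exists2 w, integral w & eval g x - eval g y = w * (x - y).
Proof.
move=> x_int y_int; elim/poly_ind: g => [|g c [w w_int wE]].
  by exists 0; [apply: integral0 | rewrite !rmorph0 !horner0 subrr mul0r].
exists (eval g x + w * y).
  by apply: integral_add (integral_eval _ x_int) (integral_mul w_int y_int).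
rewrite !evalE; transitivity (eval g x * (x - y) + (eval g x - eval g y) * y).
  by ring.
by rewrite wE; ring.
Qed.

Lemma galois_1f : galois 1 {:L}.
Proof.
rewrite /galois sub1v normalFieldf andbT /=; apply/separableP=> x _.
by apply: pcharf0_separable => p; rewrite (fmorph_pchar (in_alg L)) pchar_num.
Qed.

Lemma fixed_integral_unit z :
    integral z -> integral z^-1 ->
    (forall s : gal_of {:L}, s \in 'Gal({:L} / 1)%g -> s z = z) ->
  z != 0 -> z = 1 \/ z = -1.
Proof.
move=> z_int zV_int z_fixed z_neq0.
have : z \in 1%VS.
  by rewrite -(galois_fixedField galois_1f); apply/fixedFieldP; rewrite ?memvf.
case/vlineP=> c zE.
have [m cE] : exists m : int, c = m%:~R.
  by apply: (@rational_integral_int L); rewrite -zE.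
have [n cVE] : exists n : int, c^-1 = n%:~R.
  apply: (@rational_integral_int L).
  by have := fmorphV (in_alg L) c; rewrite /= -zE => ->.
have c_neq0 : c != 0 by apply: contraNneq z_neq0 => c0; rewrite zE c0 scale0r.
have mn1 : m * n = 1.
  by apply: (@intr_inj rat); rewrite rmorphM /= -cE -cVE divff.
have : (m == 1) || (m == -1) by apply/(@unitrPr int m); exists n.
rewrite zE cE; case/orP => /eqP->; [left|right]; first by rewrite scale1r.
by rewrite rmorphN1 scaleN1r.
Qed.

Lemma gal_family_independent n (s : 'I_n -> gal_of {:L}) (v : 'I_n -> L) :
    injective s -> (forall z, \sum_i v i * s i z = 0) ->
  forall i, v i = 0.
Proof.
move=> s_inj v0 i; apply/eqP; apply: contraT => vi_neq0.
pose c (y : gal_of {:L}) := \sum_(j | s j == y) v j.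
have cE j : c (s j) = v j.
  by rewrite /c (big_pred1 j) // => k; rewrite /= (inj_eq s_inj).
have [||z _] := @gal_independent_contra _ L {:L}%AS (mem (s @: setT)) c (s i).
- by apply: imset_f.
- by rewrite cE.
case/eqP; rewrite big_imset /=; last by move=> ? ? _ _; apply: s_inj.
rewrite -[RHS](v0 z); apply: eq_big => j; first by rewrite inE.
by rewrite cE.
Qed.

Lemma difference_quotient_integral g x1 x2 y1 y2 :
    integral x1 -> integral x2 -> y1 = eval g x1 -> y2 = eval g x2 ->
  integral ((y1 - y2) / (x1 - x2)).
Proof.
move=> x1_int x2_int -> ->; have [->|x12_neq] := eqVneq x1 x2.
  by rewrite !subrr mul0r; apply: integral0.
have [w w_int ->] := eval_difference g x1_int x2_int.
by rewrite mulfK // subr_eq0.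
Qed.

(** Both [P] and [Q] are rational, and [Q / P] is a unit among the algebraic
    integers because [X] and [Y] are integral polynomials in each other. *)
Lemma sign_of_fixed_product (X Y : nat -> L) g h i j k l :
    (forall n, integral (X n)) ->
    (forall n, Y n = eval g (X n)) -> (forall n, X n = eval h (Y n)) ->
    X i != X j -> X k != X l ->
    let P := (X i - X j) * (X k - X l) in
    let Q := (Y i - Y j) * (Y k - Y l) in
    (forall s : gal_of {:L}, s \in 'Gal({:L} / 1)%g -> s P = P /\ s Q = Q) ->
  Q = P \/ Q = - P.
Proof.
move=> X_int YE XE neq_ij neq_kl P Q PQ_fixed.
have Y_int n : integral (Y n) by rewrite YE; apply: integral_eval.
have Y_neq m n : X m != X n -> Y m != Y n.
  by apply: contraNneq => eqY; rewrite !XE eqY.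
have P_neq0 : P != 0 by rewrite mulf_neq0 // subr_eq0.
have Q_neq0 : Q != 0 by rewrite mulf_neq0 // subr_eq0 Y_neq.
have PQ_int : integral (Q / P).
  rewrite /Q /P invfM mulrACA.
  by apply: integral_mul; apply: (@difference_quotient_integral g).
have QP_int : integral (P / Q).
  rewrite /Q /P invfM mulrACA.
  by apply: integral_mul; apply: (@difference_quotient_integral h).
have [|||/(canRL (divfK P_neq0))->|/(canRL (divfK P_neq0))->] :=
    fixed_integral_unit PQ_int.
- by rewrite invf_div.
- by move=> s /PQ_fixed[sP sQ]; rewrite fmorph_div /= sP sQ.
- by rewrite mulf_neq0 // invr_eq0.
- by left; rewrite mul1r.
by right; rewrite mulN1r.
Qed.

(** With [E1 = e1 D1] and [E2 = e2 D2], opposite signs would give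
    [E3 = - e1 (D1 + D2)], while [D3 = D2 - D1]; equality up to sign then forces
    [2 D1 = 0] or [2 D2 = 0]. *)
Lemma pluecker_signs (D1 D2 D3 E1 E2 E3 : L) :
    D1 != 0 -> D2 != 0 ->
    D1 - D2 + D3 = 0 -> E1 - E2 + E3 = 0 ->
    E1 = D1 \/ E1 = - D1 -> E2 = D2 \/ E2 = - D2 -> E3 = D3 \/ E3 = - D3 ->
  D1 * E2 = D2 * E1.
Proof.
have twice_neq0 (z : L) : z != 0 -> z + z != 0.
  move=> z_neq0; rewrite -mulr2n -mulr_natl mulf_neq0 //.
  by rewrite -(rmorph_nat (in_alg L)) fmorph_eq0.
move=> /twice_neq0 D1_neq0 /twice_neq0 D2_neq0 DE EE.
have -> : D3 = D2 - D1 by apply/eqP; rewrite -subr_eq0 -DE; apply/eqP; ring.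
have -> : E3 = E2 - E1 by apply/eqP; rewrite -subr_eq0 -EE; apply/eqP; ring.
move=> [->|->] [->|->] E3E; try ring.
all: exfalso; case: E3E => E3E.
- move/eqP: D2_neq0; apply.
  by transitivity (D2 - D1 - (- D2 - D1)); [ring | rewrite E3E subrr].
- move/eqP: D1_neq0; apply.
  by transitivity (- (D2 - D1) - (- D2 - D1)); [ring | rewrite E3E subrr].
- move/eqP: D1_neq0; apply.
  by transitivity (D2 - - D1 - (D2 - D1)); [ring | rewrite E3E subrr].
move/eqP: D2_neq0; apply.
by transitivity (D2 - - D1 - - (D2 - D1)); [ring | rewrite E3E subrr].
Qed.

(** The products [D 0 1 2 3], [D 0 2 1 3], [D 0 3 1 2] of differences of conjugates
    are rational, so they agree for [x] and [y] up to a common sign.  The matrix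
    of the conjugates of [1, x, y, x * y] is then singular, and a vector in its
    left kernel is a linear relation between the four automorphisms on the span
    of these elements. *)
Lemma klein_four_dependent (x y : L) g h :
    'Gal({:L} / 1) \isog klein_four ->
    integral x -> y = eval g x -> x = eval h y ->
    (forall s : gal_of {:L}, s != 1%g -> s x != x) ->
    span [:: 1; x; y; x * y] != {:L}%VS.
Proof.
move=> /isog_klein_four[s [t [uniq4 s2 t2 st GE]]] x_int yE xE x_gen.
have sK z : s (s z) = z by rewrite -galM ?memvf // s2 gal_id.
have tK z : t (t z) = z by rewrite -galM ?memvf // t2 gal_id.
have stC z : s (t z) = t (s z) by rewrite -!galM ?memvf // st.
have fixed_st z : s z = z -> t z = z ->
    forall r : gal_of {:L}, r \in 'Gal({:L} / 1)%g -> r z = z.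
  move=> sz tz r; rewrite GE !inE => /orP[/orP[/orP[]|]|]/eqP-> //.
    by rewrite gal_id.
  by rewrite galM ?memvf // sz.
pose e i := nth 1%g [:: 1; s; t; s * t]%g i.
have e_inj m n : (m < 4)%N -> (n < 4)%N -> (e m == e n) = (m == n).
  by move=> m_lt n_lt; rewrite nth_uniq.
have eE z : ((e 0 z = z) * (e 1 z = s z) * (e 2 z = t z) * (e 3 z = t (s z)))%type.
  by rewrite /e /= gal_id galM ?memvf.
pose D i j k l z := (e i z - e j z) * (e k z - e l z).
have D_fixed z r : r \in 'Gal({:L} / 1)%g ->
   [/\ r (D 0 1 2 3 z) = D 0 1 2 3 z, r (D 0 2 1 3 z) = D 0 2 1 3 z
     & r (D 0 3 1 2 z) = D 0 3 1 2 z].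
  by move=> r_G; split; apply: fixed_st r_G; rewrite /D !eE rmorphM !rmorphB /=;
    rewrite ?stC ?sK ?tK ?stC ?sK ?tK; ring.
have X_int n : integral (e n x) by apply: integral_image.
have YE n : e n y = eval g (e n x) by rewrite yE eval_rmorph.
have XE n : e n x = eval h (e n y) by rewrite {1}xE eval_rmorph.
have X_neq m n : (m < 4)%N -> (n < 4)%N -> m != n -> e m x != e n x.
  move=> m_lt n_lt; rewrite -(e_inj m n) // eq_mulgV1 => /x_gen.
  apply: contraNneq => eq_x.
  by rewrite galM ?memvf // eq_x -galM ?memvf // mulgV gal_id.
have sign i j k l := @sign_of_fixed_product (e ^~ x) (e ^~ y) g h i j k l X_int YE XE.
have cross : D 0 1 2 3 x * D 0 2 1 3 y = D 0 2 1 3 x * D 0 1 2 3 y.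
  apply: (@pluecker_signs _ _ (D 0 3 1 2 x) _ _ (D 0 3 1 2 y)).
  - by rewrite mulf_neq0 // subr_eq0 X_neq.
  - by rewrite mulf_neq0 // subr_eq0 X_neq.
  - by rewrite /D; ring.
  - by rewrite /D; ring.
  - apply: sign => [||r r_G]; rewrite ?X_neq //.
    by have [xE1 _ _] := D_fixed x r r_G; have [yE1 _ _] := D_fixed y r r_G.
  - apply: sign => [||r r_G]; rewrite ?X_neq //.
    by have [_ xE1 _] := D_fixed x r r_G; have [_ yE1 _] := D_fixed y r r_G.
  apply: sign => [||r r_G]; rewrite ?X_neq //.
  by have [_ _ xE1] := D_fixed x r r_G; have [_ _ yE1] := D_fixed y r r_G.
apply/eqP => span_full.
pose A : 'M[L]_4 := \matrix_(i, j) nth 0 [:: 1; e i x; e i y; e i x * e i y] j.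
have : \det A == 0.
  by rewrite (det_bilinear_rows (e ^~ x) (e ^~ y)); apply/eqP; move/eqP: cross;
    rewrite -subr_eq0 => /eqP.
case/det0P=> v v_neq0 vA0.
case/negP: v_neq0; apply/eqP/rowP=> i; rewrite mxE.
apply: (@gal_family_independent _ (fun i : 'I_4 => e i) (v 0)) => [m n /eqP|z].
  by rewrite e_inj // => /eqP/val_inj.
have vB0 j : (j < 4)%N -> \sum_m v 0 m * e m (nth 0 [:: 1; x; y; x * y] j) = 0.
  move=> j_lt; transitivity ((v *m A) 0 (Ordinal j_lt)).
    rewrite mxE; apply: eq_bigr => m _; rewrite mxE /=; congr (_ * _).
    by move: j j_lt => [|[|[|[|]]]] //= _; rewrite ?rmorph1 ?rmorphM.
  by rewrite vA0 mxE.
have z_span : z \in span (in_tuple [:: 1; x; y; x * y]) by rewrite span_full memvf.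
rewrite (coord_span z_span).
transitivity (\sum_(j < 4) coord (in_tuple [:: 1; x; y; x * y]) j z *:
   \sum_m v 0 m * e m (nth 0 [:: 1; x; y; x * y] j)).
  under [RHS]eq_bigr => j _ do rewrite scaler_sumr.
  rewrite exchange_big /=; apply: eq_bigr => m _; rewrite linear_sum mulr_sumr.
  by apply: eq_bigr => j _; rewrite linearZ /= scalerAr.
by rewrite big1 // => j _; rewrite vB0 ?scaler0.
Qed.

End Galois.

(** * Primitive integral relations *)

Lemma primitive_multiple (f : {poly rat}) : f != 0 ->
  exists (c : rat) (q : {poly int}),
    [/\ c != 0, f = c *: map_poly intr q & zcontents q = 1].
Proof.
have [q [c c_neq0 ->]] := rat_poly_scale f.
rewrite scaler_eq0 invr_eq0 intr_eq0 (negbTE c_neq0) /= => q_neq0.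
have {}q_neq0 : q != 0 by apply: contraNneq q_neq0 => ->; rewrite rmorph0.
exists (c%:~R^-1 * (zcontents q)%:~R), (zprimitive q); split.
- by rewrite mulf_neq0 ?invr_eq0 ?intr_eq0 ?zcontents_eq0.
- by rewrite {1}(zpolyEprim q) map_polyZ scalerA.
by rewrite zcontents_primitive q_neq0.
Qed.

Lemma not_free_relation (F : fieldType) (V : vectType F) n (X : n.-tuple V) :
  ~~ free X -> exists2 k : 'rV[F]_n, k != 0 & \sum_i k 0 i *: X`_i = 0.
Proof.
pose comb (k : 'rV[F]_n) := \sum_i k 0 i *: X`_i.
have comb_lin : linear comb.
  move=> c u v; rewrite /comb scaler_sumr -big_split; apply: eq_bigr => i _ /=.
  by rewrite !mxE scalerDl scalerA.
pose combL := GRing.isLinear.Build _ _ _ _ comb comb_lin.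
pose combLin : {linear 'rV[F]_n -> V} := HB.pack comb combL.
have combE k : linfun combLin k = comb k by rewrite lfunE.
move=> nfreeX; exists (vpick (lker (linfun combLin))); last first.
  by rewrite -/(comb _) -combE; apply/eqP; rewrite -memv_ker memv_pick.
rewrite vpick0; apply: contraNneq nfreeX => ker0.
apply/freeP=> k k0 i.
have /lker0P inj : lker (linfun combLin) == 0%VS by rewrite ker0.
have /inj/rowP/(_ i) : linfun combLin (\row_i k i) = linfun combLin 0.
  rewrite !combE /comb [RHS]big1 => [|j _]; last by rewrite mxE scale0r.
  by rewrite -[RHS]k0; apply: eq_bigr => j _; rewrite mxE.
by rewrite !mxE.
Qed.

Lemma primitive_relation (K : fieldExtType rat) (x0 x1 x2 x3 : K) :
    ~~ free [:: x0; x1; x2; x3] ->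
  exists n0 n1 n2 n3 : int,
    n0%:~R * x0 + n1%:~R * x1 + n2%:~R * x2 + n3%:~R * x3 = 0 /\
    forall p : nat, prime p ->
      ~~ [&& (p %| n0)%Z, (p %| n1)%Z, (p %| n2)%Z & (p %| n3)%Z].
Proof.
move/(@not_free_relation _ _ _ [tuple x0; x1; x2; x3]) => [k k_neq0 k_rel].
(* The coefficients are packed in a polynomial so as to clear denominators and
   contents at once. *)
pose f := \poly_(i < 4) k 0 (inord i).
have fE (i : 'I_4) : f`_i = k 0 i by rewrite coef_poly ltn_ord inord_val.
have f_neq0 : f != 0.
  apply: contraNneq k_neq0 => f0; apply/eqP/rowP=> i.
  by rewrite -fE f0 coef0 mxE.
have [c [q [c_neq0 fq q_prim]]] := primitive_multiple f_neq0.
have q_large i : (4 <= i)%N -> q`_i = 0.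
  move=> i_ge4; have : f`_i = 0 by rewrite coef_poly ltnNge i_ge4.
  rewrite fq coefZ coef_map /= => /eqP.
  by rewrite mulf_eq0 (negbTE c_neq0) intr_eq0 => /eqP.
exists q`_0, q`_1, q`_2, q`_3; split.
  have termE i x : f`_i *: x = c *: ((q`_i)%:~R * x).
    by rewrite fq coefZ coef_map /= -scalerA scaler_int mulrzl.
  apply: (scalerI c_neq0); rewrite scaler0 -[RHS]k_rel.
  rewrite !big_ord_recl big_ord0 -!fE !termE /bump /= addr0.
  by rewrite !scalerDr !addrA.
move=> p p_prime; apply/negP => /and4P[p0 p1 p2 p3].
have : (p %| zcontents q)%Z.
  rewrite dvdz_contents; apply/polyOverP=> i.
  case: (ltnP i 4) => [|/q_large->]; last exact: dvdz0.
  by move: i => [|[|[|[|]]]].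
by rewrite q_prim dvdzE /= dvdn1; case: p p_prime {p0 p1 p2 p3} => [|[]].
Qed.

(** * The theorem *)

Theorem lemma1p4 (K : fieldExtType rat) (L : splittingFieldType rat)
    (iota : 'AHom(K, L))
    (hK : \dim {:K} = 4%N)
    (hL : is_normal_closure iota)
    (hG : 'Gal({:L} / 1) \isog klein_four)
    (O : {pred K}) (hO : is_order O) (h2 : two_times_monogenic O) :
  type_I O.
Proof.
have [_ O_int O_frac] := hO.
have [a [b [a_mono b_mono ab_inequiv]]] := h2.
have [[aO aP] [bO bP]] := (a_mono, b_mono).
have [g bE] : exists g : {poly int}, b = (map_poly intr g).[a] by apply/aP.
have [h aE] : exists h : {poly int}, a = (map_poly intr h).[b] by apply/bP.
have gen c : monogenizer O c -> <<1; c>>%VS = fullv.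
  case=> _ cP; apply/eqP; rewrite eqEsubv subvf; apply/subvP=> x _.
  have [_ [_ [/cP[p ->] /cP[q ->] _ ->]]] := O_frac x.
  by apply: rpred_div; rewrite -map_poly_alg_intr mempx_Fadjoin //;
    apply/polyOver1P; eexists.
have deg c : monogenizer O c -> adjoin_degree 1 c = 4%N.
  move=> /gen c_gen; have := dim_Fadjoin 1 c.
  by rewrite c_gen hK dimv1 muln1.
have dimL : \dim {:L} = 4%N.
  have := galois_dim (galois_1f L); rewrite dimv1 divn1 => ->.
  by rewrite (card_isog hG) cardsT card_prod !card_ord.
(* [L] is a Galois extension of degree [4] that contains [K]. *)
have limg_full : limg iota = fullv.
  apply/eqP; rewrite eqEdim subvf /= dimL -hK limg_dim_eq //.
  by rewrite (eqP (AHom_lker0 iota)) capv0.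
have nfree : ~~ free [:: 1; a; b; a * b].
  apply/negP=> free_ab.
  have span_ab : span [:: 1; a; b; a * b] = fullv.
    apply/eqP; rewrite eqEdim subvf /= hK.
    by move: free_ab; rewrite /free => /eqP ->.
  have bE' : iota b = (map_poly intr g).[iota a] by rewrite bE eval_rmorph.
  have aE' : iota a = (map_poly intr h).[iota b] by rewrite {1}aE eval_rmorph.
  have := klein_four_dependent hG (integral_image iota (O_int a aO)) bE' aE'.
  rewrite -[1]/(1 : L) -(rmorph1 iota) -rmorphM.
  rewrite -[[:: _; _; _; _]]/(map iota [:: 1; a; b; a * b]) -limg_span span_ab.
  rewrite limg_full eqxx => /(_ _)/negP[] // s s_neq1.
  apply: contra s_neq1 => /eqP s_fix; apply/gal_eqP=> z _; rewrite gal_id.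
  (* An automorphism fixing [iota a] fixes the field that it generates. *)
  suff : (limg iota <= fixedField [set s])%VS.
    rewrite limg_full => /subvP/(_ z (memvf z))/fixedFieldP=> -> //.
      by rewrite memvf.
    by rewrite inE.
  rewrite -(gen a a_mono) aimg_adjoin aimg1.
  apply/FadjoinP; split; first by apply: sub1v.
  by apply/fixedFieldP=> [|_ /set1P->]; rewrite ?memvf.
have [n0 [n1 [n2 [n3 [rel prim]]]]] := primitive_relation nfree.
have deg2 : (2 < adjoin_degree 1 a)%N by rewrite deg.
have deg1 : (1 < adjoin_degree 1 b)%N by rewrite deg.
have relE : n3%:~R * (a * b) + n2%:~R * b = (- n1)%:~R * a + (- n0)%:~R.
  by apply/eqP; rewrite -subr_eq0 -rel; apply/eqP; ring.
have det_unit : - n1 * n2 - - n0 * n3 \is a GRing.unit.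
  apply: (mobius_unimodular (O_int a aO) deg2 (O_int b bO) deg1 bE aE relE).
  move=> p /prim; rewrite !rpredN; apply: contra.
  by case/and4P=> -> -> -> ->.
(* A unimodular relation with [n3 = 0] is an equivalence of [a] and [b]. *)
have n3_neq0 : n3 != 0.
  apply/eqP=> n3_0; apply: ab_inequiv.
  move: det_unit relE; rewrite n3_0 mulr0 subr0 unitrM mul0r add0r.
  case/andP=> n1_unit n2_unit relE.
  have {n1_unit} n1E : (- n1 == 1) || (- n1 == -1) by [].
  have {n2_unit} n2E : (n2 == 1) || (n2 == -1) by [].
  exists (- n0 * n2); move: relE.
  case/orP: n1E => /eqP->; case/orP: n2E => /eqP->; rewrite ?mul1r.
  - by left; rewrite relE; ring.
  - by right; transitivity (- ((-1)%:~R * b)); [ring | rewrite relE; ring].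
  - by right; rewrite relE; ring.
  by left; transitivity (- ((-1)%:~R * b)); [ring | rewrite relE; ring].
have den_neq0 : n3%:~R * a + n2%:~R != 0.
  apply/eqP=> den0; have := @linear_eval_dvd K a n3 n2 0 0 (O_int a aO).
  rewrite den0 mulr0z mul0r !dvd0z (negbTE n3_neq0) /= => /(_ _ erefl).
  by rewrite (ltnW deg2) => /(_ isT).
pose M : 'M[int]_2 :=
  \matrix_(i, j) nth 0 (nth [::] [:: [:: - n1; - n0]; [:: n3; n2]] i) j.
exists a, b, M; split; split=> //; rewrite ?mxE //=.
- exact: gen.
- by rewrite unitmxE det_mx22 !mxE.
by rewrite -relE mulrA -mulrDl mulrAC divff ?mul1r.
Qed.
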